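(* Let $a=(a_k)_{k\ge1}$ be a sequence of pairwise distinct complex numbers with $a_1=0$, and let $\mu$ be a strict partition. Suppose $f\in\Gamma$ satisfies: (1) $f(x(\mu))=H_a(\mu)$; (2) $\deg f\le|\mu|$; (3) $f(x(\lambda))=0$ for every strict partition $\lambda$ with $|\lambda|\le|\mu|$ and $\lambda\ne\mu$. Then $f=P_{\mu;a}$.
   Context: A polynomial is supersymmetric if it is symmetric and substituting $x_i=t$, $x_j=-t$ ($i<j$) gives a polynomial independent of $t$. $\Gamma$ is the algebra of supersymmetric functions: sequences $(f_m)_{m\ge1}$ of supersymmetric polynomials $f_m(x_1,\dots,x_m)$ with $f_{m+1}(x_1,\dots,x_m,0)=f_m$ and bounded degrees; $f(x_1,\dots,x_m)$ means $f_m$. Strict partitions are $\mu=(\mu_1>\dots>\mu_l>0)$, $\ell(\mu)=l$, $|\mu|=\sum\mu_i$. Put $(x\mid a)^k=\prod_{m=1}^k(x-a_m)$. For $\ell(\mu)=l\le m$, $$P_{\mu;a}(x_1,\dots,x_m)=\frac1{(m-l)!}\sum_{\omega\in S(m)}\prod_{i=1}^l (x_{\omega(i)}\mid a)^{\mu_i}\prod_{1\le i\le l,\ i<j\le m}\frac{x_{\omega(i)}+x_{\omega(j)}}{x_{\omega(i)}-x_{\omega(j)}},$$ and $0$ if $\ell(\mu)>m$; this defines $P_{\mu;a}\in\Gamma$. For a strict partition $\lambda$, $x(\lambda)=(a_{\lambda_1+1},\dots,a_{\lambda_{\ell(\lambda)}+1})$. Also $$H_a(\mu)=\prod_{k=1}^{\ell(\mu)}(a_{\mu_k+1}\mid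 a)^{\mu_k}\prod_{1\le i<j\le\ell(\mu)}\frac{a_{\mu_i+1}+a_{\mu_j+1}}{a_{\mu_i+1}-a_{\mu_j+1}}.$$
   Formalization: The formal theorem additionally assumes a_{i+1}+a_{j+1} ≠ 0 for all 1 ≤ i < j with i+j ≤ |μ|; without it the claim fails, e.g. a=(0,1,-1,3,4,...), μ=(2,1), f=0 satisfies (1)-(3) but P_{μ;a} ≠ 0. *)

(* Defs.v *)
From HB Require Import structures.
From mathcomp Require Import all_boot all_order all_fingroup all_algebra.
From mathcomp Require Export reals complex mpoly.

Set Implicit Arguments.
Unset Strict Implicit.
Unset Printing Implicit Defensive.

Import GRing.Theory.
Local Open Scope ring_scope.

(* A parameter sequence (a_k)_{k >= 1} is a function a : nat -> K whose value
   at 0 is never used.  A strict partition is the list of its parts, so that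
   |mu| is [sumn mu], l(mu) is [size mu] and mu_(i+1) is [nth 0 mu i]. *)

Definition strict_partition (mu : seq nat) : bool :=
  sorted gtn mu && (0%N \notin mu).

Definition facpow (A : nzRingType) (a : nat -> A) (x : A) (n : nat) : A :=
  \prod_(1 <= k < n.+1) (x - a k).

Section Supersymmetric.
Variable K : fieldType.

(* p with t for x_i, - t for x_j, as a polynomial in t over K[x_1, .., x_m] *)
Definition subst_opp (m : nat) (i j : 'I_m) (p : {mpoly K[m]}) :
    {poly {mpoly K[m]}} :=
  mmap (fun c : K => (c%:MP)%:P)
       (fun k : 'I_m => if k == i then 'X else if k == j then - 'X
                        else ('X_k)%:P)
       p.

Definition supersymmetric (m : nat) (p : {mpoly K[m]}) : Prop :=
  p \is symmetric /\
  forall i j : 'I_m, (i < j)%N ->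
    exists q : {mpoly K[m]}, subst_opp i j p = q%:P.

(* p(x_1, .., x_m, 0) *)
Definition set_last0 (m : nat) (p : {mpoly K[m.+1]}) : {mpoly K[m]} :=
  p \mPo [tuple (if unlift ord_max i is Some j then 'X_j else 0) | i < m.+1].

(* [f m] is f_(m+1), so that f stands for the sequence (f_m)_{m >= 1}. *)
Definition mpoly_sequence := forall m : nat, {mpoly K[m.+1]}.

(* [msize p] is deg p + 1, and 0 for p = 0. *)
Definition degree_le (f : mpoly_sequence) (d : nat) : Prop :=
  forall m, (msize (f m) <= d.+1)%N.

Definition in_Gamma (f : mpoly_sequence) : Prop :=
  [/\ forall m, supersymmetric (f m),
      forall m, set_last0 (f m.+1) = f m
    & exists d, degree_le f d].

(* f(s_1, .., s_l), where l = size s.  For l = 0 this is f_1(0), which by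
   stability is the value of every f_m at (0, .., 0). *)
Definition eval_seq (f : mpoly_sequence) (s : seq K) : K :=
  (f (size s).-1).@[fun i => s`_i].

Variable a : nat -> K.

Definition xpart (la : seq nat) : seq K := [seq a k.+1 | k <- la].

Definition multiparamH (mu : seq nat) : K :=
  (\prod_(k < size mu) facpow a (a (nth 0%N mu k).+1) (nth 0%N mu k)) *
  \prod_(i < size mu) \prod_(j < size mu | (i < j)%N)
    ((a (nth 0%N mu i).+1 + a (nth 0%N mu j).+1) /
     (a (nth 0%N mu i).+1 - a (nth 0%N mu j).+1)).

(* P_{mu;a}(x_1, .., x_m), in the field of rational functions where its
   defining formula makes sense *)
Definition multiparamP (mu : seq nat) (m : nat) : {fraction {mpoly K[m]}} :=
  let F := @tofrac {mpoly K[m]} in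
  if (size mu <= m)%N then
    ((m - size mu)`!%:R)^-1 *
    \sum_(w : 'S_m)
      ((\prod_(i < m | (i < size mu)%N)
          F (facpow (fun k => (a k)%:MP) 'X_(w i) (nth 0%N mu i))) *
       \prod_(i < m | (i < size mu)%N) \prod_(j < m | (i < j)%N)
          (F ('X_(w i) + 'X_(w j)) / F ('X_(w i) - 'X_(w j))))
  else 0.

End Supersymmetric.

(* Main.v *)
(* Uniqueness.  Let g be supersymmetric of degree at most d and vanish at all
   x(la) with |la| <= d.  By induction on the number n of variables, g vanishes
   when one variable is 0 and, by supersymmetry, when two variables are t, -t;
   hence g = q * \prod_i x_i * \prod_(i < j) (x_i + x_j).  At x(la) with
   l(la) = n the cofactor of q is nonzero, so q * \prod_(i < j) (x_i - x_j)
   vanishes at all the points (a_(l_1 + 2), .., a_(l_n + 2)) with l_1 + .. + l_n <= d - n.  Its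
   degree is at most d - n, so it is 0 by Newton interpolation.

   Existence.  The numerator of P_mu;a over the Vandermonde product is
   antisymmetric, so P_mu;a is a polynomial; evaluating it at pairwise distinct
   elements of an extension field of K by the defining formula shows that it is
   in Gamma and takes the same values as f at the points x(la). *)

From HB Require Import structures.
Require Import Defs.
From mathcomp Require Import all_boot all_order all_fingroup all_algebra.
From mathcomp Require Import reals complex mpoly.
From mathcomp Require Import zify.
From mathcomp Require boolp.

Set Implicit Arguments.
Unset Strict Implicit.
Unset Printing Implicit Defensive.

Import GRing.Theory.
Local Open Scope ring_scope.

(** * Substitution and divisibility in multivariate polynomials *)

Section Evaluation.
Variables (n : nat) (R : nzRingType) (S T : comNzRingType).

Lemma eq_mmap (f f' : R -> S) (h h' : 'I_n -> S) (p : {mpoly R[n]}) :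
  f =1 f' -> h =1 h' -> mmap f h p = mmap f' h' p.
Proof.
move=> eq_f eq_h; apply: eq_bigr => m _; rewrite eq_f; congr (_ * _).
by apply: eq_bigr => i _; rewrite eq_h.
Qed.

Lemma rmorph_mmap (phi : {rmorphism S -> T}) (f : R -> S) (h : 'I_n -> S)
    (p : {mpoly R[n]}) :
  phi (mmap f h p) = mmap (phi \o f) (phi \o h) p.
Proof.
rewrite rmorph_sum; apply: eq_bigr => m _; rewrite rmorphM; congr (_ * _).
by rewrite rmorph_prod; apply: eq_bigr => i _; rewrite rmorphXn.
Qed.

End Evaluation.

Lemma mmap_id (n : nat) (R : nzRingType) (p : {mpoly R[n]}) :
  mmap (@mpolyC n R) (fun i => 'X_i) p = p.
Proof.
rewrite [RHS]mpolyE; apply: eq_bigr => m _.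
by rewrite mul_mpolyC mmap1_id.
Qed.

(** * Degrees of sums, products and substitutions *)

Section Degree.
Variables (n : nat) (R : idomainType).
Implicit Types p q u : {mpoly R[n]}.

Lemma msizeM_leS p q d e :
  (msize p <= d.+1 -> msize q <= e.+1 -> msize (p * q) <= (d + e).+1)%N.
Proof.
move=> hp hq; have [->|p0] := eqVneq p 0; first by rewrite mul0r msize0.
have [->|q0] := eqVneq q 0; first by rewrite mulr0 msize0.
by rewrite msizeM // -ltnS prednK ?addn_gt0 ?lt0n ?msize_poly_eq0 ?p0 //
  (leq_trans (leq_add hp hq)) // addSn addnS.
Qed.

Lemma msize_prod_le (I : Type) (r : seq I) (P : pred I) (F : I -> {mpoly R[n]})
    (d : I -> nat) :
  (forall i, P i -> msize (F i) <= (d i).+1)%N ->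
  (msize (\prod_(i <- r | P i) F i) <= (\sum_(i <- r | P i) d i).+1)%N.
Proof.
move=> leF; elim/big_rec2: _ => [|i d' p Pi le_p]; first by rewrite msizeC oner_eq0.
exact: msizeM_leS (leF i Pi) le_p.
Qed.

Lemma msize_sum_le (I : Type) (r : seq I) (P : pred I) (F : I -> {mpoly R[n]})
    d :
  (forall i, P i -> msize (F i) <= d)%N ->
  (msize (\sum_(i <- r | P i) F i) <= d)%N.
Proof.
move=> leF; elim/big_ind: _ => [|p q hp hq|//]; first by rewrite msize0.
by apply: leq_trans (msizeD_le _ _) _; rewrite geq_max hp.
Qed.

Lemma msize_mmap_le k (h : 'I_k -> {mpoly R[n]}) (p : {mpoly R[k]}) :
  (forall i, msize (h i) <= 2)%N ->
  (msize (mmap (@mpolyC n R) h p) <= msize p)%N.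
Proof.
move=> leh; rewrite /mmap big_seq; apply: msize_sum_le => m /msize_mdeg_lt.
apply: leq_trans; rewrite mul_mpolyC (leq_trans (msizeZ_le _ _)) //.
rewrite mdegE; apply: msize_prod_le => i _.
elim: (m i) => [|d IHd]; first by rewrite expr0 msizeC oner_eq0.
by rewrite exprS; apply: (@msizeM_leS _ _ 1).
Qed.

Lemma msizeM_lin q l : q != 0 -> msize l = 2 -> msize (q * l) = (msize q).+1.
Proof.
move=> q0 l2; rewrite msizeM ?l2 ?addn2 //.
by rewrite -msize_poly_eq0 l2.
Qed.

Lemma msizeM_prod_lin (I : eqType) (r : seq I) (F : I -> {mpoly R[n]}) q :
  q != 0 -> {in r, forall i, msize (F i) = 2} ->
  msize (q * \prod_(i <- r) F i) = (msize q + size r)%N.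
Proof.
elim: r q => [|i r IHr] q q0 F2; first by rewrite big_nil mulr1 addn0.
have Fi2 : msize (F i) = 2 by rewrite F2 ?mem_head.
rewrite big_cons mulrA IHr ?msizeM_lin ?addSnnS // => [|j rj].
  by rewrite mulf_eq0 negb_or q0 -msize_poly_eq0 Fi2.
by rewrite F2 // inE rj orbT.
Qed.

(** The coefficient of ['X_i] in the difference is 1 minus its coefficient in [u], hence nonzero. *)
Lemma msizeX_linear i u :
  (msize u <= 2)%N -> u@_(U_(i)%MM) != 1 -> msize ('X_i - u) = 2.
Proof.
move=> u2 ui; apply/eqP; rewrite eqn_leq (leq_trans (msizeD_le _ _)) /=; last first.
  by rewrite msizeN geq_max msizeX mdeg1.
suff /msize_mdeg_lt: U_(i)%MM \in msupp ('X_i - u) by rewrite mdeg1.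
by rewrite mcoeff_msupp mcoeffB mcoeffX eqxx subr_eq0 eq_sym.
Qed.

End Degree.

Section Substitution.
Variables (n : nat) (R : idomainType).
Implicit Types (p q u : {mpoly R[n]}) (i : 'I_n).

Definition msubst i u : {mpoly R[n]} -> {mpoly R[n]} :=
  mmap (@mpolyC n R) (fun k => if k == i then u else 'X_k).

HB.instance Definition _ i u := GRing.RMorphism.copy (msubst i u)
  (mmap (@mpolyC n R) (fun k => if k == i then u else 'X_k)).

Lemma msubstX i u k : msubst i u 'X_k = if k == i then u else 'X_k.
Proof. by rewrite /msubst mmapX mmap1U. Qed.

Lemma mmap_msubst (S : comNzRingType) (f : {rmorphism R -> S}) (h : 'I_n -> S)
    i u p :
  mmap f h (msubst i u p) =
  mmap f (fun k => if k == i then mmap f h u else h k) p.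
Proof.
rewrite /msubst rmorph_mmap; apply: eq_mmap => k /=; first exact: mmapC.
by case: ifP => // _; rewrite mmapX mmap1U.
Qed.

Lemma meval_msubst (h : 'I_n -> R) i u p :
  (msubst i u p).@[h] = p.@[fun k => if k == i then u.@[h] else h k].
Proof. exact: mmap_msubst. Qed.

(** Modulo ['X_i - u] the substitution is the identity on constants and on variables, and
    congruences add and multiply. When [msubst i u p = 0] this is the factor theorem. *)
Lemma sub_msubst_dvd i u p : exists q, p - msubst i u p = q * ('X_i - u).
Proof.
have closedM p1 p2 : (exists q, p1 - msubst i u p1 = q * ('X_i - u)) ->
    (exists q, p2 - msubst i u p2 = q * ('X_i - u)) ->
    exists q, p1 * p2 - msubst i u (p1 * p2) = q * ('X_i - u).
  (* Writing s for the substitution, p1 p2 - s(p1) s(p2) = p1 (p2 - s(p2)) + (p1 - s(p1)) s(p2). *)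
  move=> [q1 e1] [q2 e2]; exists (p1 * q2 + q1 * msubst i u p2).
  rewrite mulrDl -mulrA -e2 mulrAC -e1 rmorphM mulrBr mulrBl.
  by rewrite addrA subrK.
have X_ok k : exists q, 'X_k - msubst i u 'X_k = q * ('X_i - u).
  rewrite msubstX; have [->|_] := eqVneq k i; first by exists 1; rewrite mul1r.
  by exists 0; rewrite subrr mul0r.
have C_ok c : exists q, c%:MP - msubst i u c%:MP = q * ('X_i - u).
  by exists 0; rewrite /msubst mmapC subrr mul0r.
elim/mpolyind: p => [|c m p _ _ [q e]]; first by rewrite -mpolyC0; exact: C_ok.
suff [q' e']: exists q, c *: 'X_[m] - msubst i u (c *: 'X_[m]) = q * ('X_i - u).
  by exists (q' + q); rewrite mulrDl -e -e' rmorphD opprD addrACA.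
rewrite -mul_mpolyC; apply: (closedM); first exact: C_ok.
rewrite mpolyXE_id; elim/big_ind: _ => [||k _]; first by rewrite -mpolyC1; exact: C_ok.
  exact: closedM.
elim: (m k) => [|d IHd]; first by rewrite expr0 -mpolyC1; exact: C_ok.
by rewrite exprS; apply: (closedM).
Qed.

(** The factors are split off one at a time. A substitution for a later factor kills [p] but not the
    factor already removed, so in a domain it kills the quotient. *)
Lemma dvd_prod_msubst (I : eqType) (r : seq I) (v : I -> 'I_n)
    (u : I -> {mpoly R[n]}) p :
  uniq r -> {in r, forall x, msubst (v x) (u x) p = 0} ->
  {in r &, forall x y, x != y -> msubst (v x) (u x) ('X_(v y) - u y) != 0} ->
  exists q, p = q * \prod_(x <- r) ('X_(v x) - u x).
Proof.
elim: r p => [|x r IHr] p /=; first by exists p; rewrite big_nil mulr1.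
move=> /andP[xr ur] p0 indep.
have [q] := sub_msubst_dvd (v x) (u x) p.
rewrite p0 ?mem_head // subr0 => def_p.
have [y yr|y z yr zr yz|q' def_q] := IHr q ur.
- have yxr : y \in x :: r by rewrite inE yr orbT.
  have /eqP := p0 y yxr; rewrite def_p rmorphM mulf_eq0 => /orP[/eqP //|].
  rewrite (negbTE (indep y x yxr (mem_head _ _) _)) //.
  by apply: contraNneq xr => <-.
- by apply: indep => //; rewrite inE ?yr ?zr orbT.
by exists q'; rewrite def_p def_q big_cons mulrA mulrAC.
Qed.

End Substitution.

(* Newton interpolation in several variables: the nodes [b i (l i)] with
   [\sum_i l i < d] determine a polynomial of degree less than [d].  The index
   [k] bounds the variables that are not yet specialized. *)
Lemma newton_specialized (K : fieldType) (n k d : nat) (b : 'I_n -> nat -> K)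
    (p : {mpoly K[n]}) (v : 'I_n -> {mpoly K[n]}) :
  (k <= n)%N -> (forall i, injective (b i)) -> (msize p <= d)%N ->
  (forall l : 'I_n -> nat, (forall i : 'I_n, (k <= i)%N -> l i = 0%N) ->
     (\sum_i l i < d)%N -> p.@[fun i => b i (l i)] = 0) ->
  (forall i : 'I_n, (k <= i)%N -> v i = (b i 0%N)%:MP) ->
  mmap (@mpolyC n K) v p = 0.
Proof.
elim: k d b p v => [|k IHk] d b p v le_kn b_inj.
  case: d => [|d]; first by rewrite leqn0 msize_poly_eq0 => /eqP ->; rewrite mmap0.
  move=> _ p0 v0; have := p0 (fun=> 0%N) (fun _ _ => erefl _).
  rewrite big1 // => /(_ isT)/(congr1 (@mpolyC n K)); rewrite mpolyC0 => <-.
  rewrite /meval rmorph_mmap; apply: eq_mmap => // i; exact: v0.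
pose i := Ordinal le_kn.
(* Inner induction on the degree bound: [p] is its value at [x_i = b i 0], settled by the outer
   hypothesis on [k], plus [q * ('X_i - c)] with [q] of smaller degree. *)
elim: d b p b_inj => [|d IHd] b p b_inj.
  by rewrite leqn0 msize_poly_eq0 => /eqP ->; rewrite mmap0.
move=> le_p p0 v0; set c := (b i 0%N)%:MP_[n].
have [q def_q] := sub_msubst_dvd i c p.
have subst0 : mmap (@mpolyC n K) v (msubst i c p) = 0.
  rewrite mmap_msubst (IHk d.+1 b) ?(ltnW le_kn) // => [l l0 sl|j le_kj].
    by apply: p0 => // j /ltnW; exact: l0.
  case: eqVneq => [->|ne_ji]; rewrite ?mmapC //.
  by apply: v0; rewrite ltn_neqAle le_kj andbT eq_sym.
rewrite -[p](subrK (msubst i c p)) rmorphD /= subst0 addr0 def_q rmorphM /=.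
(* The nodes for [q] drop the first one of variable [i]. The index sum at a node of [p] is then one
   larger, which matches the drop in degree. *)
pose b' j m := b j (m + (j == i))%N.
rewrite (IHd b') ?mul0r // => [j m m'|||j lt_kj]; last first.
- by rewrite v0 // /b' -val_eqE /= gtn_eqF.
- move=> l l0 lt_l.
  have bi_neq : b i (l i).+1 - b i 0%N != 0.
    by rewrite subr_eq0; apply/eqP => /b_inj.
  apply: (mulIf bi_neq); rewrite mul0r.
  have := congr1 (meval (fun j => b' j (l j))) def_q.
  rewrite mevalB meval_msubst mevalM mevalB mevalXU /c mevalC /b' eqxx addn1 => <-.
  rewrite (p0 (fun j => l j + (j == i))%N) ?sub0r => [|j lt_kj|]; first last.
  - rewrite big_split /= [X in (_ + X)%N](bigD1 i) //= eqxx.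
    by rewrite [X in (_ + (_ + X))%N]big1 ?addn1 // => j /negbTE ->.
  - by rewrite l0 // -val_eqE /= gtn_eqF.
  apply/eqP; rewrite oppr_eq0; apply/eqP.
  rewrite -[RHS](p0 (fun j => if j == i then 0 else l j)%N).
  - apply: meval_eq => j; case: eqVneq => [->|_]; rewrite ?mevalC //.
    by rewrite addn0.
  - by move=> j lt_kj; case: ifP => // _; exact: l0.
  - apply: leq_ltn_trans (leqW lt_l); apply: leq_sum => j _.
    by case: ifP.
- have [->|q0] := eqVneq q 0; first by rewrite msize0.
  have lin2 : msize ('X_i - c) = 2.
    rewrite msizeX_linear ?msizeC ?(leq_trans (leq_b1 _)) //.
    by rewrite mcoeffC mnm1_eq0 mulr0 eq_sym oner_eq0.
  rewrite -ltnS -(msizeM_lin q0 lin2) -def_q.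
  apply: leq_trans (msizeD_le _ _) _; rewrite geq_max le_p msizeN.
  apply: leq_trans (msize_mmap_le _ _) le_p => j.
  by case: ifP => _; rewrite ?msizeX ?mdeg1 // msizeC (leq_trans (leq_b1 _)).
- by rewrite /b' => /b_inj /addIn.
Qed.

Lemma newton_eq0 (K : fieldType) (n d : nat) (b : 'I_n -> nat -> K)
    (p : {mpoly K[n]}) :
  (forall i, injective (b i)) -> (msize p <= d)%N ->
  (forall l : 'I_n -> nat, (\sum_i l i < d)%N -> p.@[fun i => b i (l i)] = 0) ->
  p = 0.
Proof.
move=> b_inj le_p p0; rewrite -[p]mmap_id.
apply: (newton_specialized (leqnn n) b_inj le_p) => [l _|i]; first exact: p0.
by rewrite leqNgt ltn_ord.
Qed.

(** * Supersymmetric polynomials vanishing at strict partitions *)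

Import Num.Theory.

Lemma mmap_msym (n : nat) (R : nzRingType) (S : comNzRingType)
    (f : {rmorphism R -> S}) (h : 'I_n -> S) (s : 'S_n) (p : {mpoly R[n]}) :
  mmap f h (msym s p) = mmap f (fun i => h (s i)) p.
Proof.
elim/mpolyind: p => [|c m p _ _ IHp]; first by rewrite msym0 !mmap0.
rewrite msymD !mmapD {}IHp msymZ !mmapZ; congr (_ * _ + _).
rewrite msymX !mmapX /mmap1 (reindex_inj (@perm_inj _ s)) /=.
by apply: eq_bigr => i _; rewrite mnmE permK.
Qed.

Lemma symmetric_meval_perm (n : nat) (R : comNzRingType) (s t : seq R)
    (p : {mpoly R[n]}) :
  p \is symmetric -> perm_eq s t -> size t = n ->
  p.@[fun i => s`_i] = p.@[fun i => t`_i].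
Proof.
move=> /issymP p_sym /[swap] /eqP t_n.
rewrite -[t]/(tval (Tuple t_n)) => /tuple_permP[w ->].
rewrite -[in RHS](p_sym w) /meval mmap_msym; apply: eq_mmap => // i.
by rewrite -!tnth_nth tnth_mktuple.
Qed.

(** * Products over pairs of indices *)

Definition lt_pairs n : seq ('I_n * 'I_n) :=
  [seq x : 'I_n * 'I_n <- enum {: 'I_n * 'I_n} | (x.1 < x.2)%N].

Lemma mem_lt_pairs n (x : 'I_n * 'I_n) : (x \in lt_pairs n) = (x.1 < x.2)%N.
Proof. by rewrite mem_filter mem_enum andbT. Qed.

Lemma big_lt_pairs (R : Type) (idx : R) (op : Monoid.com_law idx) n
    (F : 'I_n -> 'I_n -> R) :
  \big[op/idx]_(x <- lt_pairs n) F x.1 x.2 =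
  \big[op/idx]_(i < n) \big[op/idx]_(j < n | (i < j)%N) F i j.
Proof. by rewrite big_filter big_enum_cond pair_big_dep. Qed.

Definition diff_prod (R : comNzRingType) n (x : 'I_n -> R) : R :=
  \prod_(i < n) \prod_(j < n | (i < j)%N) (x i - x j).

Lemma diff_prodE (R : comNzRingType) n (x : 'I_n -> R) :
  diff_prod x = \prod_(y <- lt_pairs n) (x y.1 - x y.2).
Proof. by rewrite (big_lt_pairs _ (fun i j => x i - x j)). Qed.

(** The product is a Vandermonde determinant, and permuting columns multiplies it by the sign.
    Negated nodes give the factors the orientation [x i - x j] for [i < j]. *)
Lemma diff_prod_perm (R : comNzRingType) n (x : 'I_n -> R) (w : 'S_n) :
  diff_prod (fun i => x (w i)) = (-1) ^+ w * diff_prod x.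
Proof.
have detE (y : 'I_n -> R) : diff_prod y = \det (Vandermonde n (\row_i - y i)).
  rewrite det_Vandermonde; apply: eq_bigr => i _; apply: eq_bigr => j _.
  by rewrite !mxE opprK addrC.
rewrite !detE -odd_permV -det_perm mulrC -det_mulmx -col_permE.
by congr (\det _); apply/matrixP => i j; rewrite !mxE.
Qed.

Definition le_pairs n := lt_pairs n ++ [seq (i, i) | i <- enum 'I_n].

Lemma mem_le_pairs n (x : 'I_n * 'I_n) : (x \in le_pairs n) = (x.1 <= x.2)%N.
Proof.
rewrite mem_cat mem_lt_pairs [RHS]leq_eqVlt orbC; congr (_ || _).
case: x => i j /=; apply/mapP/eqP => [[k _ [-> ->]] //|/val_inj ->].
by exists j; rewrite ?mem_enum.
Qed.

Lemma uniq_le_pairs n : uniq (le_pairs n).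
Proof.
rewrite cat_uniq filter_uniq ?enum_uniq //= map_inj_uniq ?enum_uniq ?andbT.
  by apply/hasPn => _ /mapP[i _ ->]; rewrite mem_lt_pairs ltnn.
by move=> i j [].
Qed.

Lemma size_le_pairs n : size (le_pairs n) = (size (lt_pairs n) + n)%N.
Proof. by rewrite size_cat size_map size_enum_ord. Qed.

Section Divisors.
Variables (K : numFieldType) (n : nat).
Implicit Types (p q : {mpoly K[n]}) (x y : 'I_n * 'I_n).

Definition vandermonde_mpoly : {mpoly K[n]} := diff_prod (fun i => 'X_i).

Lemma msizeM_vandermonde q :
  q != 0 -> msize (q * vandermonde_mpoly) = (msize q + size (lt_pairs n))%N.
Proof.
move=> q0; rewrite /vandermonde_mpoly diff_prodE.
apply: msizeM_prod_lin => // x; rewrite mem_lt_pairs => lt_x.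
apply: msizeX_linear; first by rewrite msizeX mdeg1.
by rewrite mcoeffX eq_mnm1 -val_eqE gtn_eqF // eq_sym oner_eq0.
Qed.

Lemma vandermonde_dvd p :
  (forall i j : 'I_n, (i < j)%N -> msubst i 'X_j p = 0) ->
  exists q, p = q * vandermonde_mpoly.
Proof.
move=> p0; rewrite /vandermonde_mpoly diff_prodE.
apply: (@dvd_prod_msubst _ _ _ _ fst (fun x => 'X_x.2)).
- by rewrite filter_uniq ?enum_uniq.
- by move=> x; rewrite mem_lt_pairs => /p0.
move=> [i j] [k l]; rewrite !mem_lt_pairs /= => lt_ij lt_kl.
(* At the point with coordinates x_m = m, after putting x_i = x_j, the only difference that vanishes
   is x_i - x_j itself. *)
apply: contraNneq => /(congr1 (meval (fun i : 'I_n => (i : nat)%:R))).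
rewrite meval0 meval_msubst mevalB !mevalXU => /eqP.
rewrite -[_ == i]val_eqE -[l == i]val_eqE -pair_eqE /=  -!val_eqE /= subr_eq0.
by do 2 case: ifP; rewrite ?eqr_nat; lia.
Qed.

(* The factors are [x_i + x_j] for [i < j], and [x_i] for [i = j]. *)
Definition opp_root x : {mpoly K[n]} := if x.1 == x.2 then 0 else - 'X_x.1.

Definition sum_mpoly : {mpoly K[n]} :=
  \prod_(x <- le_pairs n) ('X_x.2 - opp_root x).

Lemma msizeM_sum_mpoly q :
  q != 0 -> msize (q * sum_mpoly) = (msize q + size (lt_pairs n) + n)%N.
Proof.
move=> q0; rewrite -addnA -size_le_pairs; apply: msizeM_prod_lin => // x _.
rewrite /opp_root; case: eqVneq => [_|ne_x]; apply: msizeX_linear.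
- by rewrite msize0.
- by rewrite mcoeff0 eq_sym oner_eq0.
- by rewrite msizeN msizeX mdeg1.
by rewrite mcoeffN mcoeffX eq_mnm1 (negbTE ne_x) oppr0 eq_sym oner_eq0.
Qed.

Lemma meval_opp_root (h : 'I_n -> K) x :
  (opp_root x).@[h] = if x.1 == x.2 then 0 else - h x.1.
Proof. by rewrite /opp_root; case: ifP; rewrite ?meval0 ?mevalN ?mevalXU. Qed.

Lemma sum_mpoly_dvd p :
  (forall i, msubst i 0 p = 0) ->
  (forall i j : 'I_n, (i < j)%N -> msubst j (- 'X_i) p = 0) ->
  exists q, p = q * sum_mpoly.
Proof.
move=> p0 pN; apply: (@dvd_prod_msubst _ _ _ _ snd opp_root).
- exact: uniq_le_pairs.
- move=> x; rewrite mem_le_pairs /opp_root; case: eqVneq => [_ _|ne_x le_x].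
    exact: p0.
  by apply: pN; rewrite ltn_neqAle ne_x.
move=> [i j] [k l]; rewrite !mem_le_pairs /= => le_ij le_kl.
(* The coordinates x_m = m + 1 are distinct and positive, so no variable and no sum of two vanishes
   before the substitution. After it, only the factor indexed by [(i, j)] does. *)
apply: contraNneq => /(congr1 (meval (fun i : 'I_n => (i.+1 : nat)%:R))).
rewrite meval0 meval_msubst mevalB !mevalXU !meval_opp_root /= => /eqP.
rewrite -[l == j]val_eqE -[k == j]val_eqE -pair_eqE /= -!val_eqE /= subr_eq0.
have sym0 (z : K) : (0 == z) = (z == 0) by exact: eq_sym.
do ?case: ifP => ?;
rewrite ?oppr0 ?opprK ?eqr_opp ?eqr_nat ?sym0 ?oppr_eq0 ?pnatr_eq0 -?addr_eq0
  -?natrD ?pnatr_eq0; lia.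

Qed.

End Divisors.

Lemma sorted_gtn_sort (s : seq nat) : uniq s -> sorted gtn (sort geq s).
Proof.
move=> us; rewrite gtn_sorted_uniq_geq sort_uniq us /=.
by apply: sort_sorted => i j; exact: leq_total.
Qed.

Lemma meval_vandermonde_eq0 (K : numFieldType) n (h : 'I_n -> K) :
  ~ injective h -> (vandermonde_mpoly K n).@[h] = 0.
Proof.
move=> h_inj; have /injectivePn[i [j ne_ij eq_h]] : ~~ injectiveb h.
  by apply/injectiveP.
rewrite /vandermonde_mpoly diff_prodE rmorph_prod /=.
wlog lt_ij : i j ne_ij eq_h / (i < j)%N => [IH|].
  case: (ltngtP i j) => [/IH|lt_ji|/val_inj]; [exact| |by move/eqP: ne_ij].
  by apply: (IH j i); rewrite // eq_sym.
rewrite (big_rem (i, j)) ?mem_lt_pairs //= mevalB !mevalXU eq_h subrr.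
by rewrite mul0r.
Qed.

Section Uniqueness.
Variables (K : numFieldType) (a : nat -> K) (d : nat).
Hypothesis a_inj :
  forall i j : nat, (0 < i)%N -> (0 < j)%N -> a i = a j -> i = j.
Hypothesis a1 : a 1%N = 0.
Hypothesis a_nonopp : forall i j : nat,
  (0 < i < j)%N -> (i + j <= d)%N -> a i.+1 + a j.+1 != 0.

Lemma symmetric_eq0 n (p : {mpoly K[n]}) :
  p \is symmetric -> (msize p <= d.+1)%N ->
  (forall i, msubst i 0 p = 0) ->
  (forall i j : 'I_n, (i < j)%N -> msubst j (- 'X_i) p = 0) ->
  (forall la, strict_partition la -> size la = n -> (sumn la <= d)%N ->
    p.@[fun i => (xpart a la)`_i] = 0) ->
  p = 0.
Proof.
move=> p_sym le_p p0 pN p_van; have [q def_p] := sum_mpoly_dvd p0 pN.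
suff qV0 : q * vandermonde_mpoly K n = 0.
  have [q0|q_n0] := eqVneq q 0; first by rewrite def_p q0 mul0r.
  have := msizeM_vandermonde q_n0; rewrite qV0 msize0 => /esym/eqP.
  by rewrite addn_eq0 msize_poly_eq0 (negbTE q_n0).
(* The node [a m.+2] is the coordinate of x(la) for a part m + 1, so |la| is the index sum plus n.
   The bound [d.+1 - n] also fits the degree, since [sum_mpoly] has n linear factors more than the
   Vandermonde product. *)
apply: (@newton_eq0 _ _ (d.+1 - n)%N (fun _ m => a m.+2)) => [i m m'||l lt_l].
- by move=> /a_inj => /(_ isT isT)[].
- have [->|q_n0] := eqVneq q 0; first by rewrite mul0r msize0.
  move: le_p; rewrite def_p msizeM_sum_mpoly // msizeM_vandermonde //.
  by move: q_n0; rewrite -msize_poly_eq0; lia.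
have sum_l : (\sum_i (l i).+1 <= d)%N.
  under eq_bigr do rewrite -addn1.
  by rewrite big_split sum_nat_const card_ord muln1 /= -ltnS addnC -ltn_subRL.
(* Nodes with a repeated index come from no strict partition; there the Vandermonde factor
   vanishes. *)
have [/injectiveP l_inj|l_ninj] := boolP (injectiveb l); last first.
  rewrite mevalM meval_vandermonde_eq0 ?mulr0 // => h_inj.
  by case/injectiveP: l_ninj => i j eq_l; apply: h_inj; rewrite eq_l.
rewrite mevalM; suff -> : q.@[fun i => a (l i).+2] = 0 by rewrite mul0r.
pose la := sort geq [seq (l i).+1 | i <- enum 'I_n].
have la_perm : perm_eq la [seq (l i).+1 | i <- enum 'I_n] by rewrite perm_sort.
have size_la : size la = n by rewrite size_sort size_map size_enum_ord.
have sum_la : (sumn la <= d)%N.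
  by rewrite (perm_sumn la_perm) sumnE big_map big_enum.
have la_strict : strict_partition la.
  rewrite /strict_partition sorted_gtn_sort ?(perm_mem la_perm) /=.
    by apply/mapP => -[].
  by rewrite map_inj_uniq ?enum_uniq // => i j [/l_inj].
have := p_van la la_strict size_la sum_la.
rewrite (@symmetric_meval_perm _ _ _ [seq a (l i).+2 | i <- enum 'I_n]) //; last 2 first.
- by rewrite (_ : [seq a (l i).+2 | i <- enum 'I_n] =
    xpart a [seq (l i).+1 | i <- enum 'I_n]) ?perm_map // /xpart -map_comp.
- by rewrite size_map size_enum_ord.
rewrite (meval_eq (v2 := fun i => a (l i).+2)) => [|i]; last first.
  by rewrite (nth_map i) ?size_enum_ord // nth_ord_enum.
(* The cofactor of [q] is nonzero here: its diagonal factors are values of [a] at indices above 1,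
   hence differ from [a 1 = 0], and its other factors are the sums excluded by [a_nonopp], two
   distinct parts adding up to at most [d]. *)
rewrite def_p mevalM => /eqP; rewrite mulf_eq0 => /orP[/eqP //|].
rewrite /sum_mpoly rmorph_prod prodf_seq_eq0 => /hasP[[i j]].
rewrite mem_le_pairs /= mevalB mevalXU meval_opp_root /=.
have [-> _|ne_ij le_ij] := eqVneq i j.
  by rewrite subr0 -a1 => /eqP/a_inj => /(_ isT isT).
rewrite opprK; suff /negbTE -> : a (l j).+2 + a (l i).+2 != 0 by [].
have ne_l : l i != l j by apply: contra_neq ne_ij; exact: l_inj.
have le_d : ((l i).+1 + (l j).+1 <= d)%N.
  apply: leq_trans sum_l; rewrite (bigD1 i) //= leq_add2l.
  by rewrite (bigD1 j) 1?eq_sym //= leq_addr.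
have [lt_l'|gt_l|/eqP] := ltngtP (l i) (l j); last by rewrite (negbTE ne_l).
  by rewrite addrC; apply: a_nonopp.
by apply: a_nonopp => //; rewrite addnC.
Qed.

End Uniqueness.

Lemma eval_seqE (K : fieldType) (g : mpoly_sequence K) (s : seq K) m :
  size s = m.+1 -> eval_seq g s = (g m).@[fun i => s`_i].
Proof. by case: s => //= x s [<-]. Qed.

(** * Vanishing under the substitutions of supersymmetry *)

Section SupersymmetricZero.
Variables (K : fieldType) (m : nat).
Implicit Types p : {mpoly K[m.+1]}.

Lemma msubst_last0 p :
  msubst ord_max 0 p =
  mmap (@mpolyC m.+1 K) (fun i : 'I_m => 'X_(lift ord_max i)) (set_last0 p).
Proof.
rewrite /set_last0 /comp_mpoly rmorph_mmap; apply: eq_mmap => i /=.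
  by rewrite mmapC.
rewrite tnth_mktuple; case: unliftP => [j ->|->]; last by rewrite eqxx mmap0.
by rewrite eq_sym (negbTE (neq_lift _ _)) mmapX mmap1U.
Qed.

(** The transposition of [i] and [j] fixes [p] and carries one substitution to the other. *)
Lemma msubst_sym0 p i j :
  p \is symmetric -> msubst j 0 p = 0 -> msubst i 0 p = 0.
Proof.
move=> /issymP p_sym p0; pose s := tperm i j.
transitivity (msym s (msubst j 0 p)); last by rewrite p0 msym0.
rewrite -{1}(p_sym s) /msubst mmap_msym rmorph_mmap.
apply: eq_mmap => k /=; first by rewrite /msym mmapC.
rewrite -(inj_eq (@perm_inj _ s) k) tpermR; case: ifP => _.
  by rewrite msym0.
by rewrite /msym mmapX mmap1U.
Qed.

(** The value of [p] at x_i = c, x_j = -c does not depend on c. Taking c = x_i gives the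
    substitution wanted, and c = 0 gives 0 because x_i = 0 already kills [p]. *)
Lemma msubst_opp0 p (i j : 'I_m.+1) :
  (i < j)%N -> (exists q, subst_opp i j p = q%:P) ->
  msubst i 0 p = 0 -> msubst j (- 'X_i) p = 0.
Proof.
move=> lt_ij [q def_q] p0.
pose h (c : {mpoly K[m.+1]}) (k : 'I_m.+1) :=
  if k == i then c else if k == j then - c else 'X_k.
have subst_q c : mmap (@mpolyC m.+1 K) (h c) p = q.
  have -> : q = horner_eval c (subst_opp i j p).
    by rewrite def_q /horner_eval hornerC.
  rewrite /subst_opp rmorph_mmap; apply: eq_mmap => k /=.
    by rewrite /horner_eval hornerC.
  by rewrite /h /horner_eval; do ?case: ifP => _; rewrite ?hornerN ?hornerX ?hornerC.
rewrite /msubst; transitivity (mmap (@mpolyC m.+1 K) (h 'X_i) p).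
  apply: eq_mmap => // k; rewrite /h; case: (eqVneq k i) => [->|//].
  by rewrite -val_eqE /= ltn_eqF.
rewrite subst_q -(subst_q 0).
transitivity (mmap (@mpolyC m.+1 K) (h 0) (msubst i 0 p)); last by rewrite p0 mmap0.
rewrite mmap_msubst; apply: eq_mmap => // k.
by rewrite /h mmap0; case: eqP.
Qed.

End SupersymmetricZero.

Section GammaUniqueness.
Variables (K : numFieldType) (a : nat -> K) (d : nat).
Hypothesis a_inj :
  forall i j : nat, (0 < i)%N -> (0 < j)%N -> a i = a j -> i = j.
Hypothesis a1 : a 1%N = 0.
Hypothesis a_nonopp : forall i j : nat,
  (0 < i < j)%N -> (i + j <= d)%N -> a i.+1 + a j.+1 != 0.

Lemma Gamma_eq0 (g : mpoly_sequence K) :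
  in_Gamma g -> degree_le g d ->
  (forall la, strict_partition la -> (sumn la <= d)%N ->
     eval_seq g (xpart a la) = 0) ->
  forall m, g m = 0.
Proof.
move=> [g_ss g_st _] g_deg g_van.
have step m : set_last0 (g m) = 0 -> g m = 0.
  move=> gm0; have [gm_sym gm_opp] := g_ss m.
  have subst0 i : msubst i 0 (g m) = 0.
    by apply: (@msubst_sym0 _ _ _ i ord_max); rewrite ?msubst_last0 ?gm0 ?mmap0.
  apply: (symmetric_eq0 a_inj a1 a_nonopp) => // [i j lt_ij|la la_str la_m la_d].
    by apply: msubst_opp0 => //; exact: gm_opp.
  by rewrite -eval_seqE ?g_van // size_map.
elim=> [|m IHm]; apply: step; last by rewrite g_st.
(* With no variables left, this constant is the value of [g] at the empty partition. *)
have /= : (set_last0 (g 0%N)).@[fun=> 0] = 0.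
  rewrite /set_last0 comp_mpoly_meval -[RHS](g_van [::]) //.
  apply: meval_eq => i; rewrite tnth_mktuple nth_nil.
  by case: unliftP => [[]//|]; rewrite meval0.
rewrite [X in X.@[_]]nvar0_mpolyC mevalC => g00; rewrite [LHS]nvar0_mpolyC g00.
by rewrite mpolyC0.
Qed.

End GammaUniqueness.

(** * The symmetrized sum and its polynomial *)

Lemma rmorph_facpow (A B : nzRingType) (f : {rmorphism A -> B}) (b : nat -> A)
    x k :
  f (facpow b x k) = facpow (f \o b) (f x) k.
Proof. by rewrite rmorph_prod; apply: eq_bigr => i _; rewrite rmorphB. Qed.

Lemma eq_facpow (A : nzRingType) (b b' : nat -> A) x k :
  b =1 b' -> facpow b x k = facpow b' x k.
Proof. by move=> eq_b; apply: eq_bigr => i _; rewrite eq_b. Qed.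

Lemma facpow_root (A : comNzRingType) (b : nat -> A) k m :
  (0 < m <= k)%N -> facpow b (b m) k = 0.
Proof.
move=> /andP[m0 le_mk]; rewrite /facpow (big_cat_nat (n := m)) //=; last first.
  exact: leqW.
by rewrite [X in _ * X]big_ltn ?ltnS // subrr mul0r mulr0.
Qed.

Section Symmetrization.
Variable mu : seq nat.

(* [antisym_sum] is the sum of [multiparamP] multiplied by [diff_prod x]. *)
Definition antisym_term (A : comNzRingType) (b : nat -> A) n (x : 'I_n -> A)
    (w : 'S_n) : A :=
  (\prod_(i < n | (i < size mu)%N) facpow b (x (w i)) (nth 0%N mu i)) *
  \prod_(i < n) \prod_(j < n | (i < j)%N)
     (if (i < size mu)%N then x (w i) + x (w j) else x (w i) - x (w j)).

Definition antisym_sum (A : comNzRingType) (b : nat -> A) n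
    (x : 'I_n -> A) : A :=
  \sum_(w : 'S_n) (-1) ^+ w * antisym_term b x w.

Definition sym_term (L : fieldType) (b : nat -> L) n (x : 'I_n -> L)
    (w : 'S_n) : L :=
  (\prod_(i < n | (i < size mu)%N) facpow b (x (w i)) (nth 0%N mu i)) *
  \prod_(i < n | (i < size mu)%N) \prod_(j < n | (i < j)%N)
     ((x (w i) + x (w j)) / (x (w i) - x (w j))).

Definition sym_sum (L : fieldType) (b : nat -> L) n (x : 'I_n -> L) : L :=
  if (size mu <= n)%N then
    ((n - size mu)`!%:R)^-1 * \sum_(w : 'S_n) sym_term b x w
  else 0.

Lemma rmorph_antisym_sum (A B : comNzRingType) (f : {rmorphism A -> B})
    (b : nat -> A) n (x : 'I_n -> A) :
  f (antisym_sum b x) = antisym_sum (f \o b) (f \o x).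
Proof.
rewrite rmorph_sum; apply: eq_bigr => w _.
rewrite /antisym_term !rmorphM !rmorph_prod rmorph_sign.
congr (_ * _); congr (_ * _); apply: eq_bigr => i _.
  by rewrite rmorph_facpow.
rewrite rmorph_prod; apply: eq_bigr => j _.
by case: ifP => _; rewrite ?rmorphB ?rmorphD.
Qed.

Lemma eq_antisym_sum (A : comNzRingType) (b b' : nat -> A) n
    (x x' : 'I_n -> A) :
  b =1 b' -> x =1 x' -> antisym_sum b x = antisym_sum b' x'.
Proof.
move=> eq_b eq_x; apply: eq_bigr => w _; congr (_ * (_ * _)).
  by apply: eq_bigr => i _; rewrite eq_x; exact: eq_facpow.
by apply: eq_bigr => i _; apply: eq_bigr => j _; rewrite !eq_x.
Qed.

Lemma eq_sym_sum (L : fieldType) (b b' : nat -> L) n (x x' : 'I_n -> L) :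
  b =1 b' -> x =1 x' -> sym_sum b x = sym_sum b' x'.
Proof.
move=> eq_b eq_x; rewrite /sym_sum; case: ifP => // _; congr (_ * _).
apply: eq_bigr => w _; congr (_ * _).
  by apply: eq_bigr => i _; rewrite eq_x; exact: eq_facpow.
by apply: eq_bigr => i _; apply: eq_bigr => j _; rewrite !eq_x.
Qed.

Lemma antisym_sum_perm (A : comNzRingType) (b : nat -> A) n (x : 'I_n -> A)
    (s : 'S_n) :
  antisym_sum b (fun i => x (s i)) = (-1) ^+ s * antisym_sum b x.
Proof.
rewrite /antisym_sum big_distrr /= [RHS](reindex_inj (mulIg s)) /=.
apply: eq_bigr => w _; rewrite odd_permM addbC signr_addb -[in RHS]mulrA signrMK.
congr (_ * (_ * _)).
  by apply: eq_bigr => i _; rewrite permM.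
by apply: eq_bigr => i _; apply: eq_bigr => j _; rewrite !permM.
Qed.

Lemma sym_sum_perm (L : fieldType) (b : nat -> L) n (x : 'I_n -> L) (s : 'S_n) :
  sym_sum b (fun i => x (s i)) = sym_sum b x.
Proof.
rewrite /sym_sum; case: ifP => // _; rewrite [in RHS](reindex_inj (mulIg s)) /=.
congr (_ * _); apply: eq_bigr => w _; congr (_ * _).
  by apply: eq_bigr => i _; rewrite permM.
by apply: eq_bigr => i _; apply: eq_bigr => j _; rewrite !permM.
Qed.

Lemma diff_prod_neq0 (L : fieldType) n (x : 'I_n -> L) :
  injective x -> diff_prod x != 0.
Proof.
move=> x_inj; apply/prodf_neq0 => i _; apply/prodf_neq0 => j lt_ij.
by rewrite subr_eq0 (inj_eq x_inj) -val_eqE ltn_eqF.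
Qed.

Lemma antisym_termE (L : fieldType) (b : nat -> L) n (x : 'I_n -> L)
    (w : 'S_n) :
  injective x ->
  antisym_term b x w = sym_term b x w * diff_prod (fun i => x (w i)).
Proof.
move=> x_inj; rewrite /antisym_term /sym_term -mulrA; congr (_ * _).
rewrite /diff_prod [X in X * _]big_mkcond -big_split /=; apply: eq_bigr => i _.
case: ifP => _; last by rewrite mul1r.
rewrite -big_split; apply: eq_bigr => j lt_ij /=; rewrite divfK //.
by rewrite subr_eq0 (inj_eq x_inj) (inj_eq perm_inj) -val_eqE ltn_eqF.
Qed.

(** The sign in [antisym_sum] cancels the one that [diff_prod] acquires when its arguments are
    permuted by [w]. *)
Lemma antisym_sumE (L : fieldType) (b : nat -> L) n (x : 'I_n -> L) :
  injective x ->
  antisym_sum b x = (\sum_w sym_term b x w) * diff_prod x.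
Proof.
move=> x_inj; rewrite big_distrl; apply: eq_bigr => w _ /=.
by rewrite antisym_termE // diff_prod_perm mulrCA signrMK.
Qed.

(** Exchanging two equal arguments changes the sign of the sum but not its value, so twice the sum
    is 0. *)
Lemma antisym_sum_eq0 (A : idomainType) (b : nat -> A) n (x : 'I_n -> A) i j :
  2%:R != 0 :> A -> i != j -> x i = x j -> antisym_sum b x = 0.
Proof.
move=> two_neq0 ne_ij eq_x; have := antisym_sum_perm b x (tperm i j).
rewrite odd_tperm ne_ij expr1 mulN1r => anti.
have eq_s : antisym_sum b (fun k => x (tperm i j k)) = antisym_sum b x.
  by apply: eq_antisym_sum => // k; case: tpermP => // ->.
move: anti; rewrite eq_s => /eqP; rewrite -addr_eq0 -mulr2n -mulr_natr.
by rewrite mulf_eq0 (negbTE two_neq0) orbF => /eqP.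
Qed.

End Symmetrization.

Lemma rmorph_diff_prod (A B : comNzRingType) (f : {rmorphism A -> B}) n
    (x : 'I_n -> A) :
  f (diff_prod x) = diff_prod (f \o x).
Proof.
rewrite rmorph_prod; apply: eq_bigr => i _; rewrite rmorph_prod.
by apply: eq_bigr => j _; rewrite rmorphB.
Qed.

Lemma tofracX_inj (K : idomainType) n :
  injective (fun i : 'I_n => tofrac 'X_i : {fraction {mpoly K[n]}}).
Proof.
move=> i j /eqP; rewrite tofrac_eq => /eqP/(congr1 (mcoeff U_(i)%MM))/eqP.
rewrite !mcoeffX eqxx eq_mnm1; case: (eqVneq j i) => [-> //|_] /=.
by rewrite oner_eq0.
Qed.

Lemma tofrac_mpoly (K : idomainType) n (p : {mpoly K[n]}) :
  tofrac p = mmap (@tofrac {mpoly K[n]} \o @mpolyC n K) (fun i => tofrac 'X_i) p.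
Proof. by rewrite -{1}[p]mmap_id rmorph_mmap. Qed.

Lemma size_lt_pairs n :
  size (lt_pairs n) = (\sum_(i < n) \sum_(j < n | (i < j)%N) 1)%N.
Proof.
by rewrite -sum1_size -(@big_lt_pairs nat 0%N addn n (fun _ _ => 1%N)).
Qed.

(** * The polynomial represented by the symmetrized sum *)

Section MultiparamPolynomial.
Variables (K : numFieldType) (a : nat -> K) (mu : seq nat).

Lemma msize_antisym_sum n :
  (size mu <= n)%N ->
  (msize (antisym_sum mu (fun k => (a k)%:MP_[n]) (fun i => 'X_i)) <=
   (sumn mu + size (lt_pairs n)).+1)%N.
Proof.
move=> le_n; apply: msize_sum_le => w _.
apply: (@msizeM_leS _ _ _ _ 0).
  by rewrite -signr_odd; case: odd; rewrite ?expr0 ?expr1 ?msizeN msizeC oner_eq0.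
apply: msizeM_leS.
  have -> : sumn mu = (\sum_(i < n | (i < size mu)%N) nth 0%N mu i)%N.
    by rewrite sumnE (big_nth 0%N) big_mkord (big_ord_widen _ _ le_n).
  apply: msize_prod_le => i _.
  have sum1 k : k = (\sum_(1 <= j < k.+1) 1)%N.
    by rewrite sum_nat_const_nat muln1 subn1.
  rewrite [X in (_ <= X.+1)%N]sum1 /facpow.
  by apply: msize_prod_le => k _; rewrite (leq_trans (msizeD_le _ _)) //
    geq_max msizeX mdeg1 msizeN msizeC (leq_trans (leq_b1 _)).
rewrite size_lt_pairs.
apply: msize_prod_le => i _; apply: msize_prod_le => j _.
by case: ifP => _; rewrite (leq_trans (msizeD_le _ _)) // ?msizeN !msizeX !mdeg1.
Qed.

(** The last clause makes the defining formula available at any point with distinct coordinates in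
    an extension field; the later identities are checked at such points, mostly generic ones in a
    fraction field. *)
Lemma multiparamP_poly n : {p : {mpoly K[n]} |
  [/\ p \is symmetric, (msize p <= (sumn mu).+1)%N &
      forall (L : fieldType) (f : {rmorphism K -> L}) (x : 'I_n -> L),
        injective x -> mmap f x p = sym_sum mu (f \o a) x]}.
Proof.
apply: boolp.cid.
have [le_n|gt_n] := leqP (size mu) n; last first.
  exists 0; split=> [||L f x _]; first exact: rpred0; first by rewrite msize0.
  by rewrite mmap0 /sym_sum leqNgt gt_n.
pose N := antisym_sum mu (fun k => (a k)%:MP_[n]) (fun i => 'X_i).
have [|q def_N] := @vandermonde_dvd _ _ N.
  move=> i j lt_ij; rewrite /N rmorph_antisym_sum.
  apply: (@antisym_sum_eq0 _ _ _ _ _ i j); last first.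
  - by rewrite /= !msubstX eqxx; case: eqP.
  - by rewrite -val_eqE ltn_eqF.
  by rewrite -mpolyC1 -mpolyCMn mpolyC_eq0 pnatr_eq0.
pose p := ((n - size mu)`!%:R)^-1 *: q.
have pE (L : fieldType) (f : {rmorphism K -> L}) (x : 'I_n -> L) :
    injective x -> mmap f x p = sym_sum mu (f \o a) x.
  move=> x_inj; rewrite mmapZ fmorphV rmorph_nat /sym_sum le_n; congr (_ * _).
  apply: (mulIf (diff_prod_neq0 x_inj)); rewrite -antisym_sumE //.
  have -> : diff_prod x = mmap f x (vandermonde_mpoly K n).
    rewrite rmorph_diff_prod; apply: eq_bigr => i _; apply: eq_bigr => j _ /=.
    by rewrite !mmapX !mmap1U.
  rewrite -rmorphM -def_N rmorph_antisym_sum.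
  by apply: eq_antisym_sum => k /=; rewrite ?mmapC // mmapX mmap1U.
exists p; split=> //.
(* Symmetry is tested at the generic point of the fraction field, whose coordinates are distinct in
   any order. *)
- apply/issymP => s; apply/eqP; rewrite -tofrac_eq /msym; apply/eqP.
  rewrite rmorph_mmap [RHS]tofrac_mpoly !pE.
  + exact: sym_sum_perm.
  + exact: tofracX_inj.
  + by move=> i j /(@tofracX_inj K n (s i) (s j))/perm_inj.
- apply: leq_trans (msizeZ_le _ _) _.
  have [->|q_neq0] := eqVneq q 0; first by rewrite msize0.
  have := msize_antisym_sum le_n; rewrite -/N def_N msizeM_vandermonde //.
  by rewrite -addSn leq_add2r.
Qed.

Definition multiparamP_mpoly n := sval (multiparamP_poly n).

Lemma multiparamP_mpoly_sym n : multiparamP_mpoly n \is symmetric.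
Proof. by rewrite /multiparamP_mpoly; case: multiparamP_poly => p []. Qed.

Lemma msize_multiparamP_mpoly n :
  (msize (multiparamP_mpoly n) <= (sumn mu).+1)%N.
Proof. by rewrite /multiparamP_mpoly; case: multiparamP_poly => p []. Qed.

Lemma mmap_multiparamP_mpoly n (L : fieldType) (f : {rmorphism K -> L})
    (x : 'I_n -> L) :
  injective x -> mmap f x (multiparamP_mpoly n) = sym_sum mu (f \o a) x.
Proof.
by rewrite /multiparamP_mpoly; case: multiparamP_poly => p [? ? pE] /=; exact: pE.
Qed.

Lemma tofrac_multiparamP_mpoly n :
  tofrac (multiparamP_mpoly n) = multiparamP a mu n.
Proof.
rewrite tofrac_mpoly mmap_multiparamP_mpoly; last exact: tofracX_inj.
rewrite /sym_sum /multiparamP; case: ifP => // _; congr (_ * _).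
apply: eq_bigr => w _; congr (_ * _).
  by apply: eq_bigr => i _; rewrite rmorph_facpow.
by apply: eq_bigr => i _; apply: eq_bigr => j _; rewrite rmorphD rmorphB.
Qed.

End MultiparamPolynomial.

Lemma sum_perm_last (R : nmodType) n (F : 'S_n.+1 -> R) :
  \sum_(w : 'S_n.+1 | w ord_max == ord_max) F w =
  \sum_(s : 'S_n) F (lift_perm ord_max ord_max s).
Proof.
pose unlift_fun (w : 'S_n.+1) k := odflt k (unlift ord_max (w (lift ord_max k))).
have unlift_funK (w : 'S_n.+1) k :
    w ord_max = ord_max -> lift ord_max (unlift_fun w k) = w (lift ord_max k).
  move=> w_max; rewrite /unlift_fun; case: unliftP => [//|/eqP].
  by rewrite -[X in _ == X]w_max (inj_eq perm_inj) eq_sym (negbTE (neq_lift _ _)).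
rewrite (reindex (lift_perm ord_max ord_max)) /=.
  by apply: eq_bigl => s; rewrite lift_perm_id eqxx.
(* Inverse of the lift. The default [1] can only occur for permutations that move the last point. *)
pose restr w :=
  if injectiveP (unlift_fun w) is ReflectT inj then perm inj else 1%g.
exists restr => [s _|w /eqP w_max]; apply/permP => k.
  have sE : unlift_fun (lift_perm ord_max ord_max s) =1 s.
    by move=> j; rewrite /unlift_fun lift_perm_lift liftK.
  rewrite /restr; case: injectiveP => [inj|[]]; first by rewrite permE sE.
  by move=> i j; rewrite !sE; exact: perm_inj.
rewrite /restr; case: injectiveP => [inj|[]]; last first.
  by move=> i j /(congr1 (lift ord_max)); rewrite !unlift_funK // =>
    /perm_inj/lift_inj.
case: (unliftP ord_max k) => [j ->|->]; last by rewrite lift_perm_id.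
by rewrite lift_perm_lift permE unlift_funK.
Qed.

Section SymmetrizedTerms.
Variables (L : fieldType) (b : nat -> L) (mu : seq nat).

Lemma sym_term_eq0 n (x : 'I_n -> L) (w : 'S_n) (i j : 'I_n) :
  (i < j)%N -> (i < size mu)%N -> x (w i) + x (w j) = 0 ->
  sym_term mu b x w = 0.
Proof.
move=> lt_ij lt_i x0; rewrite /sym_term [X in _ * X](bigD1 i) //=.
by rewrite [X in _ * (X * _)](bigD1 j) //= x0 !mul0r mulr0.
Qed.

(* The factors where [t] and [- t] both occur to the right of [c] cancel:
   [(c + t) / (c - t) * ((c - t) / (c + t)) = 1]. *)
Lemma sym_term_opp n (x x' : 'I_n -> L) (w : 'S_n) (i j : 'I_n) :
  injective x -> injective x' -> i != j ->
  x j = - x i -> x' j = - x' i ->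
  (forall k, k != i -> k != j -> x k = x' k) ->
  sym_term mu b x w = sym_term mu b x' w.
Proof.
move=> x_inj x'_inj ne_ij xj x'j eq_x.
pose p := (w^-1)%g i; pose q := (w^-1)%g j.
have wp : w p = i by rewrite permKV.
have wq : w q = j by rewrite permKV.
have ne_pq : p != q by rewrite (inj_eq perm_inj).
(* If t or -t stands at one of the first l(mu) positions, the numerator t + (-t) occurs and the term
   is 0 at both points. *)
have kill (y : 'I_n -> L) : y j = - y i -> (minn p q < size mu)%N ->
    sym_term mu b y w = 0.
  move=> yj; have [lt_pq|lt_qp|eq_pq] := ltngtP p q => lt_mu.
  - by apply: (@sym_term_eq0 _ y w p q); rewrite ?wp ?wq ?yj ?subrr.
  - by apply: (@sym_term_eq0 _ y w q p); rewrite ?wp ?wq ?yj ?addNr.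
  - by case/eqP: ne_pq; exact: val_inj.
have [lt_mu|] := ltnP (minn p q) (size mu); first by rewrite !kill.
rewrite leq_min => /andP[le_p le_q].
have x_off (k : 'I_n) : (k < size mu)%N ->
    [/\ k != p, k != q & x (w k) = x' (w k)].

  move=> lt_k.
  have ne_kp : k != p by apply: contraTneq lt_k => ->; rewrite -leqNgt.
  have ne_kq : k != q by apply: contraTneq lt_k => ->; rewrite -leqNgt.
  by split=> //; apply: eq_x; rewrite -?wp -?wq (inj_eq perm_inj).
rewrite /sym_term; congr (_ * _); apply: eq_bigr => k lt_k.
  by have [_ _ ->] := x_off k lt_k.
have [ne_kp ne_kq eq_xk] := x_off k lt_k.
have pair1 (y : 'I_n -> L) : injective y -> y j = - y i ->
    (y (w k) + y (w p)) / (y (w k) - y (w p)) *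
    ((y (w k) + y (w q)) / (y (w k) - y (w q))) = 1.
  move=> y_inj yj; rewrite wp wq yj opprK.
  have nz_m : y (w k) - y i != 0.
    by rewrite subr_eq0 (inj_eq y_inj) -wp (inj_eq perm_inj).
  have nz_p : y (w k) + y i != 0.
    by rewrite -[y i]opprK -yj subr_eq0 (inj_eq y_inj) -wq (inj_eq perm_inj).
  by rewrite mulf_div [X in _ / X]mulrC divff // mulf_neq0.
have split2 (y : 'I_n -> L) : injective y -> y j = - y i ->
    \prod_(s < n | (k < s)%N) ((y (w k) + y (w s)) / (y (w k) - y (w s))) =
    \prod_(s < n | [&& (k < s)%N, s != p & s != q])
      ((y (w k) + y (w s)) / (y (w k) - y (w s))).
  move=> y_inj yj; rewrite (bigD1 p) ?(leq_trans lt_k) //=.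
  rewrite (bigD1 q) ?(leq_trans lt_k) 1?eq_sym //= mulrA pair1 // mul1r.
  by apply: eq_bigl => s; rewrite andbA.
rewrite !split2 //; apply: eq_bigr => s /and3P[_ ne_sp ne_sq].
by rewrite eq_xk [x (w s)]eq_x // -?wp -?wq (inj_eq perm_inj).
Qed.

(** The permutation [s] only moves positions from [size mu] on. For each [i] before them, all of
    them lie in the range [j > i], so the inner product is merely reordered. *)
Lemma sym_term_perm n (x : 'I_n -> L) (w s : 'S_n) :
  (forall i : 'I_n, (i < size mu)%N -> s i = i) ->
  sym_term mu b x (s * w)%g = sym_term mu b x w.
Proof.
move=> s_fix.
have s_ge (i : 'I_n) : (size mu <= i)%N -> (size mu <= s i)%N.
  move=> le_i; have [//|lt_si] := leqP (size mu) (s i).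
  have e : s i = i by apply: (@perm_inj _ s); exact: s_fix.
  by rewrite e ltnNge le_i in lt_si.
rewrite /sym_term; congr (_ * _); apply: eq_bigr => i lt_i.
  by rewrite permM s_fix.
rewrite [RHS](reindex_inj (@perm_inj _ s)) /=.
apply: eq_big => [j|j lt_j]; last by rewrite !permM s_fix.
have [lt_j|le_j] := ltnP j (size mu); first by rewrite s_fix.
by rewrite !(leq_trans lt_i) // s_ge.
Qed.

(* Only the terms with the extra variable [0] in a position past [size mu]
   survive, since [facpow b 0] vanishes; these positions are interchangeable. *)
Lemma sum_sym_term_last0 n (x : 'I_n.+1 -> L) :
  b 1%N = 0 -> 0%N \notin mu -> (size mu <= n.+1)%N ->
  x ord_max = 0 -> (forall i, x (lift ord_max i) != 0) ->
  \sum_w sym_term mu b x w =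
  (n.+1 - size mu)%:R * \sum_w sym_term mu b (fun i => x (lift ord_max i)) w.
Proof.
move=> b1 mu0 le_mu x0 x_neq0.
rewrite (partition_big (fun w : 'S_n.+1 => (w^-1)%g ord_max) predT) //=.
have mu_gt0 i : (i < size mu)%N -> (0 < nth 0%N mu i)%N.
  by move=> lt_i; rewrite lt0n; apply: contra mu0 => /eqP <-; exact: mem_nth.
rewrite (bigID (fun p : 'I_n.+1 => (p < size mu)%N)) /=.
rewrite [X in X + _]big1 ?add0r; last first.
  move=> p lt_p; apply: big1 => w /eqP def_p.
  rewrite /sym_term (bigD1 p) //= -def_p permKV x0 -b1 facpow_root ?mul0r //.
  by rewrite def_p mu_gt0.
(* The transposition of [p] and the last position fixes the first l(mu) positions, so it leaves
   every term unchanged. *)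
transitivity (\sum_(p < n.+1 | ~~ (p < size mu)%N)
    \sum_(w : 'S_n.+1 | w ord_max == ord_max) sym_term mu b x w).
  apply: eq_bigr => p le_p; rewrite [RHS](reindex_inj (mulgI (tperm p ord_max))).
  apply: eq_big => [w|w _].
    by rewrite permM tpermR -(inj_eq (@perm_inj _ w)) permKV eq_sym.
  rewrite sym_term_perm // => i lt_i; rewrite tpermD //.
    by apply: contraNneq le_p => ->.
  rewrite eq_sym; apply: contraTneq lt_i => ->.
  by rewrite -leqNgt /= (leq_trans _ (leq_ord p)) // leqNgt.
have card_ge : #|[pred p : 'I_n.+1 | ~~ (p < size mu)%N]| = (n.+1 - size mu)%N.
  have card_lt : #|[pred p : 'I_n.+1 | (p < size mu)%N]| = size mu.
    rewrite -sum1_card -[RHS]card_ord -[RHS]sum1_card.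
    by rewrite (big_ord_widen _ (fun=> 1%N) le_mu); exact: eq_bigl.
  have := cardC [pred p : 'I_n.+1 | (p < size mu)%N].
  rewrite card_lt card_ord => eq_n; rewrite -[X in (X - _)%N]eq_n addKn.
  exact: eq_card.
rewrite sumr_const [X in _ *+ X]card_ge -[LHS]mulr_natl.
have [lt_mu|ge_mu] := ltnP (size mu) n.+1; last first.
  have -> : (n.+1 - size mu = 0)%N by apply/eqP; rewrite subn_eq0.
  by rewrite !mul0r.
congr (_ * _); rewrite sum_perm_last; apply: eq_bigr => s _.
have lift_widen (i : 'I_n) : widen_ord (leqnSn n) i = lift ord_max i.
  by apply: val_inj; rewrite /= /bump leqNgt ltn_ord.
have prod_lift (F : 'I_n.+1 -> L) : \prod_(i < n.+1 | (i < size mu)%N) F i =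
    \prod_(i < n | (i < size mu)%N) F (lift ord_max i).
  rewrite [LHS]big_mkcond [RHS]big_mkcond big_ord_recr /= ltnNge -ltnS lt_mu mulr1.
  by apply: eq_bigr => i _; rewrite lift_widen.
rewrite /sym_term !prod_lift; congr (_ * _); apply: eq_bigr => i lt_i.
  by rewrite lift_perm_lift lift_max.
(* The factor of the last position is x / x = 1, as the other coordinates are nonzero. *)
rewrite lift_max [LHS]big_mkcond [RHS]big_mkcond big_ord_recr /= ltn_ord.
rewrite lift_perm_lift lift_perm_id x0 addr0 subr0 divff ?mulr1 //.
by apply: eq_bigr => j _; rewrite lift_widen lift_perm_lift.
Qed.

End SymmetrizedTerms.

(** * The symmetrized sum in Gamma and its values *)

(** This is a test point with opposite entries at [i] and [j]: n + 1 exceeds every index and its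
    opposite is negative. *)
Lemma ord_opp_inj (K : numFieldType) n (i j : 'I_n) :
  injective (fun k : 'I_n =>
    if k == i then n.+1%:R else if k == j then - n.+1%:R else k%:R : K).
Proof.
have ne_ord (k : 'I_n) : (n.+1 == k) = false by rewrite gtn_eqF // ltnW ?ltnS.
move=> k l /eqP; case: (eqVneq k i) => [->|_]; case: (eqVneq l i) => [->|_] //.
- by case: ifP => _; rewrite ?eqr_nat ?ne_ord // -addr_eq0 -natrD pnatr_eq0.
- case: ifP => _; rewrite ?eqr_nat 1?eq_sym ?ne_ord // -addr_eq0 -natrD.
  by rewrite pnatr_eq0.
case: (eqVneq k j) => [->|_]; case: (eqVneq l j) => [->|_] //.
- by rewrite eq_sym -addr_eq0 -natrD pnatr_eq0 addnS.
- by rewrite -addr_eq0 -natrD pnatr_eq0 addnS.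
by rewrite eqr_nat => /eqP/val_inj.
Qed.

Section MultiparamGamma.
Variables (K : numFieldType) (a : nat -> K) (mu : seq nat).
Hypothesis a1 : a 1%N = 0.
Hypothesis mu_strict : strict_partition mu.

Let mu0 : 0%N \notin mu. Proof. by case/andP: mu_strict. Qed.

(** With l = l(mu), the factor n + 1 - l counting the free positions turns 1/(n + 1 - l)! into 1/(n
    - l)!. *)
Lemma sym_sum_last0 (L : fieldType) (f : {rmorphism K -> L}) n
    (x : 'I_n.+1 -> L) :
  x ord_max = 0 -> (forall i, x (lift ord_max i) != 0) ->
  sym_sum mu (f \o a) x = sym_sum mu (f \o a) (fun i => x (lift ord_max i)).
Proof.
move=> x0 x_neq0; rewrite /sym_sum.
have [le_mu|gt_mu] := leqP (size mu) n.+1; last first.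
  by rewrite leqNgt ltnW.
rewrite sum_sym_term_last0 //=; last by rewrite a1 rmorph0.
have [le_n|gt_n] := leqP (size mu) n; last first.
  have -> : (n.+1 - size mu = 0)%N by apply/eqP; rewrite subn_eq0.
  by rewrite mul0r mulr0.
rewrite subSn // factS natrM invfM mulrA; congr (_ * _).
by rewrite mulrAC mulVf ?mul1r // -(rmorph_nat f) fmorph_eq0 pnatr_eq0.
Qed.

(** The formula applies at the point (x_1, .., x_n, 0), whose coordinates are distinct in the
    fraction field. *)
Lemma set_last0_multiparamP_mpoly n :
  set_last0 (multiparamP_mpoly a mu n.+1) = multiparamP_mpoly a mu n.
Proof.
apply/eqP; rewrite -tofrac_eq; apply/eqP.
rewrite [RHS]tofrac_mpoly mmap_multiparamP_mpoly; last exact: tofracX_inj.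
pose v i : {fraction {mpoly K[n]}} :=
  tofrac (if unlift (@ord_max n) i is Some j then 'X_j else 0).
have v_max : v ord_max = 0 by rewrite /v unlift_none tofrac0.
have v_lift j : v (lift ord_max j) = tofrac 'X_j by rewrite /v liftK.
have X_neq0 j : tofrac 'X_j != 0 :> {fraction {mpoly K[n]}}.
  by rewrite tofrac_eq0 -msize_poly_eq0 msizeX.
have v_inj : injective v.
  move=> i j; case: (unliftP ord_max i) => [i' ->|->];
    case: (unliftP ord_max j) => [j' ->|->] //; rewrite ?v_lift ?v_max.
  - by move/tofracX_inj => ->.
  - by move/eqP; rewrite (negbTE (X_neq0 _)).
  - by move/esym/eqP; rewrite (negbTE (X_neq0 _)).
pose f : {rmorphism K -> {fraction {mpoly K[n]}}} :=
  [the {rmorphism _ -> _} of @tofrac {mpoly K[n]} \o @mpolyC n K].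
transitivity (mmap f v (multiparamP_mpoly a mu n.+1)).
  rewrite /set_last0 /comp_mpoly rmorph_mmap; apply: eq_mmap => // i /=.
  by rewrite tnth_mktuple.
rewrite (mmap_multiparamP_mpoly a mu f v_inj) (sym_sum_last0 f v_max) => [|i].
  exact: eq_sym_sum.
by rewrite v_lift.
Qed.

Lemma supersymmetric_multiparamP_mpoly n :
  supersymmetric (multiparamP_mpoly a mu n).
Proof.
split=> [|i j lt_ij]; first exact: multiparamP_mpoly_sym.
have ne_ij : i != j by rewrite -val_eqE ltn_eqF.
pose u (t : {poly {mpoly K[n]}}) (k : 'I_n) :=
  if k == i then t else if k == j then - t else ('X_k)%:P.
(* Injectivity is checked after specializing [t] to [n + 1], [x_k] to [k]. *)
pose spec (h : 'I_n -> K) (c : {mpoly K[n]}) :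
    {rmorphism {poly {mpoly K[n]}} -> K} :=
  [the {rmorphism _ -> _} of meval h \o horner_eval c].
have u_inj t : (exists h c, [/\ spec h c t = n.+1%:R &
    forall k : 'I_n, k != i -> k != j -> h k = k%:R]) ->
    injective (fun k => tofrac (u t k)).
  move=> [h [c [t_n h_k]]] k l /eqP; rewrite tofrac_eq.
  move=> /eqP/(congr1 (spec h c))/eqP.
  have specE (k' : 'I_n) : spec h c (u t k') =
      if k' == i then n.+1%:R else if k' == j then - n.+1%:R else k'%:R.
    rewrite /u; case: eqVneq => [//|ne_i]; case: eqVneq => [_|ne_j].
      by rewrite rmorphN t_n.
    by rewrite /spec /= /horner_eval hornerC mevalXU h_k.
  by rewrite !specE => /eqP/ord_opp_inj.
(* The constant value is taken at t = x_i. At t = 0 two coordinates would coincide and the defining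
   formula would not apply. *)
pose q := mmap (@mpolyC n K)
  (fun k => if k == i then 'X_i else if k == j then - 'X_i else 'X_k)
  (multiparamP_mpoly a mu n).
exists q; apply/eqP; rewrite -tofrac_eq; apply/eqP.
pose f := @tofrac {poly {mpoly K[n]}} \o (@polyC {mpoly K[n]} \o @mpolyC n K).
have u_inj1 : injective (fun k => tofrac (u 'X k)).
  apply: u_inj; exists (fun k : 'I_n => k%:R), (n.+1%:R)%:MP; split=> //.
  by rewrite /spec /= /horner_eval hornerX mevalC.
have u_inj2 : injective (fun k => tofrac (u ('X_i)%:P k)).
  apply: u_inj.
  exists (fun k : 'I_n => if k == i then n.+1%:R else k%:R), 0; split.
    by rewrite /spec /= /horner_eval hornerC mevalXU eqxx.
  by move=> k /negbTE ->.
have subst_u : tofrac (subst_opp i j (multiparamP_mpoly a mu n)) =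
    mmap f (fun k => tofrac (u 'X k)) (multiparamP_mpoly a mu n).
  by rewrite rmorph_mmap; apply: eq_mmap.
have q_u : tofrac q%:P =
    mmap f (fun k => tofrac (u ('X_i)%:P k)) (multiparamP_mpoly a mu n).
  rewrite /q (rmorph_mmap (polyC)) rmorph_mmap; apply: eq_mmap => // k /=.
  by rewrite /u; case: ifP => // _; case: ifP => // _; rewrite rmorphN.
rewrite subst_u q_u !mmap_multiparamP_mpoly // /sym_sum; case: ifP => // _.
congr (_ * _); apply: eq_bigr => w _.
apply: (@sym_term_opp _ _ _ _ _ _ _ i j) => //.
- by rewrite /u eqxx eq_sym (negbTE ne_ij) eqxx tofracN.
- by rewrite /u eqxx eq_sym (negbTE ne_ij) eqxx tofracN.
by move=> k /negbTE ne_ki /negbTE ne_kj; rewrite /u ne_ki ne_kj.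
Qed.

Lemma multiparamP_Gamma : in_Gamma (fun m => multiparamP_mpoly a mu m.+1).
Proof.
split=> [m|m|]; first exact: supersymmetric_multiparamP_mpoly.
  exact: set_last0_multiparamP_mpoly.
by exists (sumn mu) => m; exact: msize_multiparamP_mpoly.
Qed.

End MultiparamGamma.

Lemma in_GammaB (K : fieldType) (f g : mpoly_sequence K) :
  in_Gamma f -> in_Gamma g -> in_Gamma (fun m => f m - g m).
Proof.
move=> [f_ss f_st [d f_deg]] [g_ss g_st [e g_deg]]; split=> [m|m|].
- have [[f_sym f_opp] [g_sym g_opp]] := (f_ss m, g_ss m).
  split=> [|i j lt_ij]; first exact: rpredB.
  have [[p def_p] [q def_q]] := (f_opp i j lt_ij, g_opp i j lt_ij).
  exists (p - q); rewrite polyCB -def_p -def_q.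
  exact: (mmapB _ (@polyC {mpoly K[m.+1]} \o @mpolyC m.+1 K)).
- by rewrite -[in RHS](f_st m) -[in RHS](g_st m); exact: comp_mpolyB.
exists (maxn d e) => m; apply: leq_trans (msizeD_le _ _) _.
by rewrite msizeN -maxnSS geq_max !leq_max f_deg g_deg orbT.
Qed.

(** * Values at strict partitions *)

Lemma sumn_nth (s : seq nat) n :
  (size s <= n)%N -> sumn s = (\sum_(i < n) nth 0%N s i)%N.
Proof.
move=> le_s; rewrite sumnE (big_nth 0%N) big_mkord (big_ord_widen _ _ le_s).
rewrite [RHS](bigID (fun i : 'I_n => (i < size s)%N)) /=.
rewrite [X in (_ + X)%N]big1 ?addn0 // => i.
by rewrite -leqNgt; exact: nth_default.
Qed.

Lemma mem_partition (s : seq nat) n x :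
  0%N \notin s -> (size s <= n)%N ->
  (x \in s) = (0 < x)%N && [exists i : 'I_n, nth 0%N s i == x].
Proof.
move=> s0 le_s; apply/idP/andP => [xs|[x_gt0 /existsP[i /eqP xE]]].
  split; first by rewrite lt0n; apply: contraNneq s0 => <-.
  have lt_x : (index x s < n)%N by apply: leq_trans le_s; rewrite index_mem.
  by apply/existsP; exists (Ordinal lt_x); rewrite /= nth_index.
rewrite -xE mem_nth // ltnNge; apply: contraTN x_gt0 => ge_i.
by rewrite -xE nth_default.
Qed.

(** A strict partition is determined by its set of positive parts, which rearranging the sequence
    padded with zeros preserves. *)
Lemma strict_partition_perm_eq (s t : seq nat) n (w : 'S_n) :
  strict_partition s -> strict_partition t ->
  (size s <= n)%N -> (size t <= n)%N ->
  (forall i, nth 0%N s (w i) = nth 0%N t i) -> s = t.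
Proof.
move=> /andP[s_sorted s0] /andP[t_sorted t0] le_s le_t st.
apply: (irr_sorted_eq (leT := gtn)) => // [y x z /[swap]|x|x].
- exact: ltn_trans.
- exact: ltnn.
rewrite (mem_partition _ s0 le_s) (mem_partition _ t0 le_t); congr (_ && _).
apply/existsP/existsP => -[i xE]; last by exists (w i); rewrite st.
by exists (w^-1 i)%g; rewrite -st permKV.
Qed.

Section Interpolation.
Variables (K : numFieldType) (a : nat -> K) (mu : seq nat).
Hypothesis a_inj :
  forall i j : nat, (0 < i)%N -> (0 < j)%N -> a i = a j -> i = j.
Hypothesis a1 : a 1%N = 0.
Hypothesis mu_strict : strict_partition mu.

(* [(a_(k+1) | a)^r] vanishes for [k < r], so a nonzero term forces
   [mu_i <= la_(w i)] for all [i]; as [|la| <= |mu|], equality holds. *)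
Lemma sym_term_neq0 n (la : 'I_n -> nat) (w : 'S_n) :
  (size mu <= n)%N -> (\sum_i la i <= sumn mu)%N ->
  sym_term mu a (fun i => a (la i).+1) w != 0 ->
  forall i, la (w i) = nth 0%N mu i.
Proof.
move=> le_mu sum_la; rewrite mulf_eq0 negb_or => /andP[/prodf_neq0 neq0 _].
have le_la (i : 'I_n) : (nth 0%N mu i <= la (w i))%N.
  have [lt_i|ge_i] := ltnP i (size mu); last by rewrite nth_default.
  rewrite leqNgt; apply: contra (neq0 i lt_i) => lt_la.
  by rewrite facpow_root.
move: sum_la; rewrite (sumn_nth le_mu) (reindex_inj (@perm_inj _ w)) /=.
have := leqif_sum (fun i (_ : true) => leqif_eq (le_la i)).
move=> [le_sum eq_sum] ge_sum; have := eq_sum; rewrite eqn_leq le_sum ge_sum.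
by move=> /esym/forallP all_eq i; have /eqP := all_eq i.
Qed.

(** A nonzero term makes [la] a rearrangement of [mu], hence equal to it; the parts being distinct,
    only the identity permutation then contributes. *)
Lemma eval_multiparamP_mpoly (la : seq nat) :
  strict_partition la -> (sumn la <= sumn mu)%N ->
  eval_seq (fun m => multiparamP_mpoly a mu m.+1) (xpart a la) =
  if la == mu then multiparamH a mu else 0.
Proof.
move=> la_strict sum_la; rewrite /eval_seq size_map; set n := (size la).-1.
have [la_sorted la0] := andP la_strict; have [mu_sorted mu0] := andP mu_strict.
have size_la : (size la <= n.+1)%N by rewrite /n leqSpred.
(* For empty [la] there is still one variable: the default part 0 gives [a 1 = 0], in agreement with
   the default coordinate 0. *)
pose x (i : 'I_n.+1) := a (nth 0%N la i).+1.
have la_inj : injective (fun i : 'I_n.+1 => nth 0%N la i).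
  rewrite /n; case: (la) la_sorted => [_ [[|//] ?] [[|//] ?] _|k la' /=].
    exact: val_inj.
  move=> sorted_la i j /eqP.
  rewrite (nth_uniq 0%N (s := k :: la')) ?ltn_ord //; first by move/eqP/val_inj.
  move: sorted_la; rewrite -[path _ _ _]/(sorted gtn (k :: la')).
  by rewrite gtn_sorted_uniq_geq => /andP[].
have x_inj : injective x by move=> i j /a_inj => /(_ isT isT)[] /la_inj.
have sum_la' : (\sum_(i < n.+1) nth 0%N la i <= sumn mu)%N by rewrite -sumn_nth.
rewrite (meval_eq (v2 := x)) => [|i]; last first.
  have [lt_i|ge_i] := ltnP i (size la); first by rewrite (nth_map 0%N).
  by rewrite /x !nth_default ?size_map // a1.
rewrite [LHS](mmap_multiparamP_mpoly a mu
  [the {rmorphism K -> K} of idfun] x_inj).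
rewrite /sym_sum; have [le_mu|gt_mu] := leqP (size mu) n.+1; last first.
  by case: eqP => // eq_la; move: gt_mu; rewrite -eq_la ltnNge size_la.
have term_neq0 w := @sym_term_neq0 n.+1 (fun i => nth 0%N la i) w le_mu sum_la'.
have [eq_la|ne_la] := eqVneq la mu; last first.
  rewrite big1 ?mulr0 // => w _; apply: contra_neq_eq ne_la => /term_neq0 la_w.
  exact: strict_partition_perm_eq la_w.
rewrite (bigD1 1%g) //= [X in _ + X]big1 ?addr0 => [|w ne_w1]; last first.
  apply: contraNeq ne_w1 => /term_neq0 la_w; apply/eqP/permP => i.
  by rewrite perm1; apply: la_inj; rewrite la_w eq_la.
(* For empty [mu] the evaluation is in one variable, and both sides equal 1. *)
rewrite /x /n eq_la /multiparamH /sym_term; case: (mu) => [|k mu'].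
  by rewrite /= !big_ord0 !big_pred0 // subn0 factS fact0 muln1 invr1 !mulr1.
rewrite /= subnn fact0 invr1 mul1r; congr (_ * _).
  by apply: eq_big => [i|i _]; [exact: ltn_ord|rewrite perm1; exact: eq_facpow].
apply: eq_big => [i|i _]; first exact: ltn_ord.
by apply: eq_bigr => j _; rewrite !perm1.
Qed.

End Interpolation.

(** Uniqueness is applied to the difference of [f] and P_mu;a. The condition [a_nonopp] excludes
    cases such as a_3 = -a_2 with mu = (2, 1), where H_a(mu) = 0 and f = 0 satisfies (1) to (3)
    although P_mu;a is nonzero. *)
Theorem theorem5p6 (R : realType) (a : nat -> R[i])
    (a_distinct : forall i j : nat, (0 < i)%N -> (0 < j)%N -> a i = a j -> i = j)
    (a1 : a 1%N = 0)
    (mu : seq nat) (mu_strict : strict_partition mu)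
    (a_nonopp : forall i j : nat,
        (0 < i < j)%N -> (i + j <= sumn mu)%N -> a i.+1 + a j.+1 != 0)
    (f : mpoly_sequence R[i]) (f_Gamma : in_Gamma f)
    (f_mu : eval_seq f (xpart a mu) = multiparamH a mu)
    (f_deg : degree_le f (sumn mu))
    (f_vanish : forall la : seq nat, strict_partition la ->
        (sumn la <= sumn mu)%N -> la <> mu -> eval_seq f (xpart a la) = 0) :
  forall m : nat, tofrac (f m) = multiparamP a mu m.+1.
Proof.
move=> m; rewrite -tofrac_multiparamP_mpoly; congr tofrac; apply/eqP.
rewrite -subr_eq0; apply/eqP; move: m.
apply: (Gamma_eq0 a_distinct a1 a_nonopp) => [|m|la la_strict sum_la].
- exact: (in_GammaB f_Gamma (multiparamP_Gamma a1 mu_strict)).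
- apply: leq_trans (msizeD_le _ _) _; rewrite msizeN geq_max f_deg.
  exact: msize_multiparamP_mpoly.
transitivity (eval_seq f (xpart a la) -
  eval_seq (fun m => multiparamP_mpoly a mu m.+1) (xpart a la)).
  exact: mevalB.
rewrite eval_multiparamP_mpoly //; case: eqP => [->|ne_la].
  by rewrite f_mu subrr.
by rewrite f_vanish // subr0.
Qed.
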